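(* Let assumptions A1), A2), A3), A4), A5) (stated in the context) hold, and let $\Phi:[0,\infty)\times\mathbb{R}^n\to\mathbb{R}$ be a continuous function. Then: (a) $\displaystyle\sup_{(\alpha,\xi)\in\partial_P\Phi(s,z)}\{\alpha+\mathcal{H}(s,z,\xi)\}\le 0$ for all $(s,z)\in[0,\infty)\times\mathbb{R}^n$ if and only if $\displaystyle\sup_{(\alpha,\xi)\in\partial_D\Phi(s,z)}\{\alpha+\mathcal{H}(s,z,\xi)\}\le 0$ for all $(s,z)\in[0,\infty)\times\mathbb{R}^n$; (b) $\displaystyle\inf_{(\alpha,\xi)\in\partial_P\Phi(s,z)}\{\alpha+\mathcal{H}(s,z,\xi)\}\ge 0$ for all $(s,z)\in[0,\infty)\times\mathbb{R}^n$ if and only if $\displaystyle\inf_{(\alpha,\xi)\in\partial^D\Phi(s,z)}\{\alpha+\mathcal{H}(s,z,\xi)\}\ge 0$ for all $(s,z)\in[0,\infty)\times\mathbb{R}^n$. (In (b) the left-hand condition involves the proximal sub-gradient $\partial_P$, the right-hand one the Dini super-gradient $\partial^D$.)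
   Context: Data: $l:[0,\infty)\times\mathbb{R}^n\times\mathbb{R}^m\to\mathbb{R}$ and $f:[0,\infty)\times\mathbb{R}^n\times\mathbb{R}^m\to\mathbb{R}^n$ are given functions, $\Omega\subset\mathbb{R}^m$ is a nonempty set (admissible control actions), and $\delta>0$ is the discount rate. Hamiltonian: $\mathcal{H}(t,x,\lambda):=\inf_{u\in\Omega}\{\langle\lambda,f(t,x,u)\rangle+e^{-\delta t}l(t,x,u)\}$ for $(t,x,\lambda)\in[0,\infty)\times\mathbb{R}^n\times\mathbb{R}^n$. Generalized gradients of $\Phi:[0,\infty)\times\mathbb{R}^n\to\mathbb{R}$: Lower Dini derivative at $(t,x)$ in direction $(\alpha,\xi)\in\mathbb{R}^{1+n}$: $D^-\Phi(t,x;\alpha,\xi):=\liminf_{r\downarrow0;\,w\to\xi}\frac{\Phi(t+r\alpha,x+rw)-\Phi(t,x)}{r}$. The upper Dini derivative $D^+\Phi$ is defined with $\limsup$ instead of $\liminf$. Dini sub-gradient: $\partial_D\Phi(t,x):=\{(\alpha,\xi)\in\mathbb{R}^{1+n} : D^-\Phi(t,x;u,v)\ge u\alpha+\langle v,\xi\rangle\ \forall(u,v)\in\mathbb{R}^{1+n}\}$. Dini super-gradient: $\partial^D\Phi(t,x):=\{(\alpha,\xi)\in\mathbb{R}^{1+n} : D^+\Phi(t,x;u,v)\le u\alpha+\langle v,\xi\rangle\ \forall(u,v)\in\mathbb{R}^{1+n}\}$. Proximal sub-gradient: $\partial_P\Phi(t,x)$ is the set of all $(\alpha,\xi)\in\mathbb{R}^{1+n}$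 for which there exist $\sigma>0$ and a neighborhood $U$ of $(t,x)$ with $\Phi(\tau,y)\ge\Phi(t,x)+\alpha(\tau-t)+\langle\xi,y-x\rangle-\sigma(|\tau-t|^2+\|y-x\|^2)$ for all $(\tau,y)\in U$. Infima (suprema) over the empty set are $+\infty$ ($-\infty$). Assumptions: A1) There exists $K_1>0$ such that for every $t\in[0,\infty)$, $u\in\Omega$: $|l(t,x,u)-l(t,z,u)|+|f(t,x,u)-f(t,z,u)|\le K_1|x-z|$ for all $x,z\in\mathbb{R}^n$. A2) There exists $K_2>0$ such that $|l(t,x,u)|+|f(t,x,u)|\le K_2(1+|x|)$ for all $t\in[0,\infty)$, $x\in\mathbb{R}^n$, $u\in\Omega$. A3) $l$ and $f$ are continuous. A4) For all $t,x$, the set $\{(e^{-\delta t}l(t,x,v),f(t,x,v))^T : v\in\Omega\}$ is convex in $\mathbb{R}^{n+1}$. A5) $\Omega$ is compact.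
   Formalization: The neighborhood U in the proximal sub-gradient is taken in R^(1+n) inside [0,∞)×R^n, so ∂_PΦ is empty at t=0; with relative neighborhoods (b) fails for l=0, f=0, Φ=0. Dini derivatives at t=0 use only admissible (r,w). *)

(* Defs.v *)
(* [0, oo[ x R^n is not a type of its own: a function on it is a total
   (curried) function on R and 'rV[R]_n, and every definition below evaluates
   it only at nonnegative times. *)
From HB Require Import structures.
From mathcomp Require Import all_boot all_order all_algebra.
From mathcomp Require Import all_classical all_reals all_analysis.
Import Order.TTheory GRing.Theory Num.Theory.
Import numFieldNormedType.Exports.

Set Implicit Arguments.
Unset Strict Implicit.
Unset Printing Implicit Defensive.

Local Open Scope classical_set_scope.
Local Open Scope ring_scope.

Definition dotp (R : realType) (n : nat) (x y : 'rV[R]_n) : R :=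
  \sum_(i < n) x 0 i * y 0 i.

(* The library's norm on 'rV[R]_n is the sup norm (same topology). *)
Definition enorm (R : realType) (n : nat) (x : 'rV[R]_n) : R :=
  Num.sqrt (dotp x x).

Section gradients.
Variables (R : realType) (n : nat).
Implicit Types (Phi : R -> 'rV[R]_n -> R) (t a : R) (x xi : 'rV[R]_n).

(* r decreases to 0 and w tends to xi, among those (r, w) for which
   (t + r a, x + r w) is in the domain of Phi.  This restriction only matters
   when t = 0 and a < 0: no (r, w) is then admissible, and the conventions
   inf set0 = +oo, sup set0 = -oo make the lower Dini derivative +oo and the
   upper one -oo. *)
Definition dini_filter t a xi : set_system (R * 'rV[R]_n) :=
  within [set p : R * 'rV[R]_n | 0 <= t + p.1 * a]
    (filter_prod (0 : R)^'+ (nbhs xi)).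

Definition dini_quotient Phi t x a (p : R * 'rV[R]_n) : \bar R :=
  ((Phi (t + p.1 * a) (x + p.1 *: p.2) - Phi t x) / p.1)%:E.

Definition lower_dini Phi t x a xi : \bar R :=
  limf_einf (dini_quotient Phi t x a) (dini_filter t a xi).

Definition upper_dini Phi t x a xi : \bar R :=
  limf_esup (dini_quotient Phi t x a) (dini_filter t a xi).

Definition dini_subgradient Phi t x : set (R * 'rV[R]_n) :=
  [set z | forall (u : R) (v : 'rV[R]_n),
     ((u * z.1 + dotp v z.2)%:E <= lower_dini Phi t x u v)%E].

Definition dini_supergradient Phi t x : set (R * 'rV[R]_n) :=
  [set z | forall (u : R) (v : 'rV[R]_n),
     (upper_dini Phi t x u v <= (u * z.1 + dotp v z.2)%:E)%E].

(* U is a neighborhood of (t, x) in R^(1+n), and the inequality is required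
   (in particular meaningful) at all its points, so U lies in the domain of
   Phi; hence there is no proximal subgradient at t = 0.  With relative
   neighborhoods, alpha could be decreased arbitrarily at t = 0, and a
   constant Phi would have proximal subgradients (alpha, 0), alpha <= 0,
   there. *)
Definition proximal_subgradient Phi t x : set (R * 'rV[R]_n) :=
  [set z | exists sigma : R, 0 < sigma /\
     exists U : set (R * 'rV[R]_n),
       [/\ nbhs (t, x) U,
           U `<=` [set p | 0 <= p.1] &
           forall (tau : R) (y : 'rV[R]_n), U (tau, y) ->
             Phi t x + z.1 * (tau - t) + dotp z.2 (y - x)
               - sigma * (`|tau - t| ^+ 2 + enorm (y - x) ^+ 2)
             <= Phi tau y]].

End gradients.

Section control.
Variables (R : realType) (n m : nat).
Variables (delta : R) (Omega : set 'rV[R]_m).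
Variables (l : R -> 'rV[R]_n -> 'rV[R]_m -> R)
          (f : R -> 'rV[R]_n -> 'rV[R]_m -> 'rV[R]_n).

Definition hamiltonian (t : R) (x lambda : 'rV[R]_n) : \bar R :=
  ereal_inf [set (dotp lambda (f t x u) + expR (- delta * t) * l t x u)%:E
            | u in Omega].

Definition assumptionA1 : Prop :=
  exists K1 : R, 0 < K1 /\
    forall t u, 0 <= t -> Omega u -> forall x z,
      `|l t x u - l t z u| + enorm (f t x u - f t z u) <= K1 * enorm (x - z).

Definition assumptionA2 : Prop :=
  exists K2 : R, 0 < K2 /\
    forall t x u, 0 <= t -> Omega u ->
      `|l t x u| + enorm (f t x u) <= K2 * (1 + enorm x).

Definition assumptionA3 : Prop :=
  {within [set p : R * 'rV[R]_n * 'rV[R]_m | 0 <= p.1.1],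
     continuous (fun p => l p.1.1 p.1.2 p.2)} /\
  {within [set p : R * 'rV[R]_n * 'rV[R]_m | 0 <= p.1.1],
     continuous (fun p => f p.1.1 p.1.2 p.2)}.

Definition assumptionA4 : Prop :=
  forall t x, 0 <= t ->
    convex_set [set ((expR (- delta * t) * l t x v : R^o), f t x v)
               | v in Omega].

Definition assumptionA5 : Prop := compact Omega.

End control.

(* Main.v *)
Require Import Defs.
From HB Require Import structures.
From mathcomp Require Import all_boot all_order all_algebra.
From mathcomp Require Import ring lra.
From mathcomp Require Import all_classical all_reals all_analysis.
Import Order.TTheory GRing.Theory Num.Theory.
Import numFieldNormedType.Exports.
Set Implicit Arguments.
Unset Strict Implicit.
Unset Printing Implicit Defensive.
Local Open Scope classical_set_scope.
Local Open Scope ring_scope.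

(**
For a fixed control [u], the inequality
[alpha + <xi, f(t,x,u)> + expR(- delta * t) * l(t,x,u) >= 0] is linear in the gradient
[(alpha, xi)] and involves it only through its pairing with the velocity
[(1, f(t,x,u))].  As the Hamiltonian is an infimum over [u], the condition
[alpha + H >= 0] says that this inequality holds for every [u], and
[alpha + H <= 0] says that, for each [e > 0], the left-hand side is below [e] for
some [u].
Three facts relate the different gradients.

- A proximal subgradient is a Dini subgradient
  ([proximal_sub_dini_subgradient]).

- Conversely, arbitrarily near a point with a Dini subgradient [(alpha, xi)]
  there are, at positive times, proximal subgradients [(alpha', xi')] with
  [alpha' + <v, xi'> >= alpha + <v, xi> - e] for all velocities [v] of norm at most
  [rho] ([dini_subgradient_approx]).  One cannot ask that [(alpha', xi')] be close
  to [(alpha, xi)].  The time component of the direction is kept fixed in a Dini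
  derivative, so a Dini subgradient does not control the function uniformly near
  purely spatial directions; and at time 0 it can be lowered at will in the time
  component.  It does control the function from below on every forward cone
  [|y - x| <= rho * (t - s)], close to its apex; minimizing over a box around such
  a cone, with a penalty that does not increase along velocities of norm at most
  [rho], gives the claim.

- For one vector field [(v0, F)] with [F] Lipschitz in space, if
  [v0 * alpha + <F, xi> + L >= 0] at all proximal supergradients of [Phi], then it
  holds at all proximal subgradients ([proximal_super_to_sub]).  Both conditions
  express that [Phi] plus the integral of [L] is nondecreasing along the flow of
  the field.
  Applied to [- Phi] and [- (v0, F)], the same statement gives the converse
  implication.

Part (a) follows from the first two facts; from right to left it is an inclusion,
and from left to right the controls are treated uniformly by compactness of
[Omega].  In part (b) one fixes the control.  From right to left, proximal
supergradients are Dini supergradients, and the third fact passes to proximal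
subgradients.  From left to right, the third fact for [- Phi] passes to proximal
supergradients, and the second one for [- Phi] to Dini supergradients.
*)

(** * The dot product and the sup norm *)

Section dot_product.
Context {R : realType} {n : nat}.
Implicit Types (x y z : 'rV[R]_n) (k : R).

Lemma dotpC x y : dotp x y = dotp y x.
Proof. by apply: eq_bigr => i _; rewrite mulrC. Qed.

Lemma dotpDl x y z : dotp (x + y) z = dotp x z + dotp y z.
Proof. by rewrite -big_split; apply: eq_bigr => i _; rewrite mxE mulrDl. Qed.

Lemma dotpZl k x y : dotp (k *: x) y = k * dotp x y.
Proof. by rewrite mulr_sumr; apply: eq_bigr => i _; rewrite mxE mulrA. Qed.

Lemma dotpNl x y : dotp (- x) y = - dotp x y.
Proof. by rewrite -scaleN1r dotpZl mulN1r. Qed.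

Lemma dotpBl x y z : dotp (x - y) z = dotp x z - dotp y z.
Proof. by rewrite dotpDl dotpNl. Qed.

Lemma dotpDr x y z : dotp x (y + z) = dotp x y + dotp x z.
Proof. by rewrite !(dotpC x) dotpDl. Qed.

Lemma dotpZr k x y : dotp x (k *: y) = k * dotp x y.
Proof. by rewrite !(dotpC x) dotpZl. Qed.

Lemma dotpNr x y : dotp x (- y) = - dotp x y.
Proof. by rewrite !(dotpC x) dotpNl. Qed.

Lemma dotpBr x y z : dotp x (y - z) = dotp x y - dotp x z.
Proof. by rewrite dotpDr dotpNr. Qed.

Lemma dotp0r x : dotp x 0 = 0.
Proof. by rewrite -(scale0r 0) dotpZr mul0r. Qed.

Lemma dotp_ge0 x : 0 <= dotp x x.
Proof. by apply: sumr_ge0 => i _; rewrite -expr2 sqr_ge0. Qed.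

Lemma sqr_enorm x : enorm x ^+ 2 = dotp x x.
Proof. by rewrite sqr_sqrtr ?dotp_ge0. Qed.

Lemma coord_le_norm x i : `|x 0 i| <= `|x|.
Proof.
by rewrite [leRHS]/Num.Def.normr/= mx_normrE; apply/bigmax_geP; right; exists (0, i).
Qed.

Lemma norm_leP x k : 0 <= k -> reflect (forall i, `|x 0 i| <= k) (`|x| <= k).
Proof.
move=> k0; apply: (iffP idP) => [xk i|xk]; first exact: le_trans (coord_le_norm x i) xk.
rewrite [leLHS]/Num.Def.normr/= mx_normrE bigmax_le// => -[i j] _ /=.
by rewrite ord1.
Qed.

Lemma norm_dotp_le x y : `|dotp x y| <= n%:R * (`|x| * `|y|).
Proof.
rewrite (le_trans (ler_norm_sum _ _ _))//.
rewrite (@le_trans _ _ (\sum_(i < n) `|x| * `|y|))//.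
  by apply: ler_sum => i _; rewrite normrM ler_pM ?coord_le_norm.
by rewrite sumr_const card_ord mulr_natl.
Qed.

Lemma sqr_norm_le_dotp x : `|x| ^+ 2 <= dotp x x.
Proof.
rewrite -(@sqr_enorm x) lerXn2r ?nnegrE ?sqrtr_ge0//.
apply/norm_leP => [|i]; first exact: sqrtr_ge0.
rewrite -sqrtr_sqr ler_wsqrtr// /dotp (bigD1 i)//= -expr2 lerDl sumr_ge0// => j _.
by rewrite -expr2 sqr_ge0.
Qed.

Lemma norm_le_enorm x : `|x| <= enorm x.
Proof. by rewrite -(@ler_pXn2r _ 2) ?nnegrE ?sqrtr_ge0// sqr_enorm sqr_norm_le_dotp. Qed.

Lemma enorm_le_norm x : enorm x <= n%:R * `|x|.
Proof.
rewrite -(@ler_pXn2r _ 2) ?nnegrE ?sqrtr_ge0 ?mulr_ge0// sqr_enorm.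
rewrite (le_trans (ler_norm _))// (le_trans (norm_dotp_le _ _))//.
rewrite exprMn -expr2 ler_wpM2r ?sqr_ge0// -natrX ler_nat.
by rewrite -mulnn; case: (n) => // k; exact: leq_pmulr.
Qed.

Lemma cvg_dotp {T} {F : set_system T} {FF : Filter F} (f g : T -> 'rV[R]_n) x y :
  f @ F --> x -> g @ F --> y -> dotp (f t) (g t) @[t --> F] --> dotp x y.
Proof.
move=> fx gy; rewrite /dotp.
apply: cvg_big => [|i _]; first exact: add_continuous.
apply: cvgM.
  exact: (cvg_comp f (fun z : 'rV[R]_n => z 0 i) fx (@coord_continuous _ _ _ _ _ _)).
exact: (cvg_comp g (fun z : 'rV[R]_n => z 0 i) gy (@coord_continuous _ _ _ _ _ _)).
Qed.

End dot_product.

(** * Compactness *)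

Section compactness.
Context {R : realType}.

(** The tube lemma, in the form of continuity in one variable that is uniform in
a compact one. *)
Lemma compact_near_uniform {X : topologicalType} {Y : topologicalType}
    {V : normedModType R} (K : set X) (g : Y * X -> V) (y0 : Y) (e : R) :
  compact K -> (forall x, K x -> {for (y0, x), continuous g}) -> 0 < e ->
  \forall y \near y0, forall x, K x -> `|g (y, x) - g (y0, x)| < e.
Proof.
move=> /compact_near_coveringP cK cg e0.
apply: (cK Y (nbhs y0) (fun y x => `|g (y, x) - g (y0, x)| < e)) => x Kx.
have e20 : 0 < e / 2 by rewrite divr_gt0.
have /cvgrPdist_lt/(_ _ e20) [[A B] /= [Ay Bx] AB] := cg x Kx.
exists (B, A) => //= -[x' y] /= [Bx' Ay'].
have /= h1 := AB (y, x') (conj Ay' Bx').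
have /= h2 := AB (y0, x') (conj (nbhs_singleton Ay) Bx').
rewrite -(subrK (g (y0, x)) (g (y, x'))) -addrA (le_lt_trans (ler_normD _ _))//.
by rewrite [ltRHS]splitr ltrD// distrC.
Qed.

(** The maximal value is continuous because [g y] tends to [g y0] uniformly on
[K], although the maximizer [m y] need not depend continuously on [y]. *)
Lemma compact_marginal {X Y : topologicalType} (K : set X) (g : Y * X -> R) :
  K !=set0 -> compact K -> continuous g ->
  exists m : Y -> X, [/\ forall y, K (m y),
    forall y x, K x -> g (y, x) <= g (y, m y) &
    continuous (fun y => g (y, m y))].
Proof.
move=> K0 cK cg.
have ex y : exists x, K x /\ forall x', K x' -> g (y, x') <= g (y, x).
  have [|x xK xmax] := @compact_EVT_max _ _ (fun x => g (y, x)) K K0 cK.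
    apply: continuous_subspaceT => x.
    apply: (@continuous_comp _ _ _ (fun x => (y, x)) g); last exact: cg.
    by apply: cvg_pair => //; exact: cvg_cst.
  by exists x; split; [exact: set_mem|move=> x' /mem_set; exact: xmax].
have [m mP] := choice ex.
exists m; split => [y|y x Kx|y]; [exact: (mP y).1|exact: (mP y).2|].
apply/cvgrPdist_lt => e e0.
have H := compact_near_uniform cK (fun x _ => cg (y, x)) e0.
near=> y'.
have H' : forall x, K x -> `|g (y', x) - g (y, x)| < e by near: y'.
have := H' _ (mP y).1; have := H' _ (mP y').1.
have := (mP y).2 _ (mP y').1; have := (mP y').2 _ (mP y).1.
rewrite !ltr_norml => h1 h2 /andP[h3 h4] /andP[h5 h6]; apply/andP; split; lra.
Unshelve. all: by end_near. Qed.

Lemma compact_closed_ball_rV n (x0 : 'rV[R]_n) (r : R) :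
  compact [set x : 'rV[R]_n | `|x - x0| <= r].
Proof.
apply: bounded_closed_compact.
  exists (`|x0| + r); split; first exact: num_real.
  move=> M /ltW rM x /= xr; rewrite (le_trans _ rM)//.
  by rewrite -(subrK x0 x) (le_trans (ler_normD _ _))// addrC lerD2l.
have -> : [set x : 'rV[R]_n | `|x - x0| <= r] = closed_ball_ Num.norm x0 r.
  by apply/seteqP; split => x; rewrite /closed_ball_/= distrC.
exact: closed_closed_ball_.
Qed.

Lemma compact_closed_ball_pair n (p0 : R * 'rV[R]_n) (r : R) :
  compact [set p : R * 'rV[R]_n | `|p - p0| <= r].
Proof.
have -> : [set p : R * 'rV[R]_n | `|p - p0| <= r] =
  `[p0.1 - r, p0.1 + r]%classic `*` [set x | `|x - p0.2| <= r].
  apply/seteqP; split => p /=; rewrite prod_normE/= ge_max in_itv/= ler_distl.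
    by move/andP.
  by case=> -> ->.
by apply: compact_setX; [exact: segment_compact|exact: compact_closed_ball_rV].
Qed.

End compactness.

(** * Generalized gradients *)

Section gradients.
Context {R : realType} {n : nat}.
Implicit Types (Phi : R -> 'rV[R]_n -> R) (t a e : R) (x v : 'rV[R]_n)
  (z : R * 'rV[R]_n).

Lemma proximal_subgradientP Phi t x z : proximal_subgradient Phi t x z <->
  exists2 sigma, 0 < sigma & \forall p \near (t, x), 0 <= p.1 /\
    Phi t x + z.1 * (p.1 - t) + dotp z.2 (p.2 - x)
      - sigma * ((p.1 - t) ^+ 2 + dotp (p.2 - x) (p.2 - x)) <= Phi p.1 p.2.
Proof.
split=> [[s [s0 [U [Utx U0 UP]]]]|[s s0 sP]]; exists s => //.
  apply: filterS Utx => -[p1 p2] Up; split; first exact: U0 Up.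
  by have := UP _ _ Up; rewrite sqr_enorm real_normK// num_real.
split=> //; eexists; split; first exact: sP.
  by move=> p [].
by move=> p1 p2 [_] /=; rewrite sqr_enorm real_normK// num_real.
Qed.

(** A neighborhood of a point at time 0 contains negative times. *)
Lemma proximal_subgradient_gt0 Phi t x z : proximal_subgradient Phi t x z -> 0 < t.
Proof.
move=> [_ [_ [U [Utx U0 _]]]].
have [/= e e0 eU] : nbhs_ball (t, x) U by rewrite nbhs_ballE.
suff : 0 <= t - e / 2 by lra.
apply: (U0 (t - e / 2, x)); apply: eU; split => /=; last exact: ballxx.
by rewrite /ball/= opprB addrC subrK gtr0_norm; lra.
Qed.

Lemma lower_dini_geP Phi t x a v (c : R) :
  (c%:E <= lower_dini Phi t x a v)%E <->
  forall e, 0 < e -> \forall p \near dini_filter t a v,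
    c - e <= (Phi (t + p.1 * a) (x + p.1 *: p.2) - Phi t x) / p.1.
Proof.
rewrite /lower_dini limf_einfE; split=> [cD e e0|H].
  have /ereal_sup_gt[_ [V FV <-]] : ((c - e)%:E <
      ereal_sup [set ereal_inf (dini_quotient Phi t x a @` V) |
                 V in dini_filter t a v])%E.
    by apply: lt_le_trans cD; rewrite lte_fin ltrBlDr ltrDl.
  move=> cV; apply: filterS FV => p Vp; rewrite -lee_fin ltW// (lt_le_trans cV)//.
  by apply: ereal_inf_lbound; exists p.
apply/lee_addgt0Pr => e e0; rewrite -leeBlDr//.
apply: le_trans (ereal_sup_ubound _); last by eexists; [exact: (H e e0)|reflexivity].
by apply: le_ereal_inf_tmp => _ [p /= cp <-]; rewrite -EFinB lee_fin.
Qed.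

(** Along [(t + r u, x + r w)] the quadratic error of a proximal subgradient is
[r ^+ 2] times a bounded factor, hence negligible in the difference quotient. *)
Lemma proximal_sub_dini_subgradient Phi t x :
  proximal_subgradient Phi t x `<=` dini_subgradient Phi t x.
Proof.
move=> z /proximal_subgradientP[s s0 sP] u v; apply/lower_dini_geP => e e0.
suff : \forall p \near filter_prod (0 : R)^'+ (nbhs v),
    u * z.1 + dotp v z.2 - e <= (Phi (t + p.1 * u) (x + p.1 *: p.2) - Phi t x) / p.1.
  by apply: filterS => p Hp _.
have rF : p.1 @[p --> filter_prod (0 : R)^'+ (nbhs v)] --> (0 : R).
  apply: cvg_trans (cvg_fst) _; exact: cvg_within.
have wF : p.2 @[p --> filter_prod (0 : R)^'+ (nbhs v)] --> v by exact: cvg_snd.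
have qF : u * z.1 + dotp p.2 z.2 - s * p.1 * (u ^+ 2 + dotp p.2 p.2)
    @[p --> filter_prod (0 : R)^'+ (nbhs v)] --> u * z.1 + dotp v z.2.
  rewrite [X in _ --> X](_ : _ =
    u * z.1 + dotp v z.2 - s * 0 * (u ^+ 2 + dotp v v)); last by ring.
  apply: cvgB; first by apply: cvgD; [exact: cvg_cst|apply: cvg_dotp => //; exact: cvg_cst].
  apply: cvgM; first by apply: cvgM => //; exact: cvg_cst.
  by apply: cvgD; [exact: cvg_cst|exact: cvg_dotp].
have pF : (t + p.1 * u, x + p.1 *: p.2) @[p --> filter_prod (0 : R)^'+ (nbhs v)] --> (t, x).
  rewrite [X in _ --> X](_ : _ = (t + 0 * u, x + 0 *: v)); last first.
    by rewrite mul0r scale0r !addr0.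
  apply: (@cvg_pair _ _ _ _ (nbhs (t + 0 * u)) (nbhs (x + 0 *: v))).
    by apply: cvgD; [exact: cvg_cst|apply: cvgM => //; exact: cvg_cst].
  by apply: cvgD; [exact: cvg_cst|exact: cvgZ].
near=> p.
have p0 : 0 < p.1.
  near: p; exists ([set r | 0 < r], setT) => [|[r w] []//]; split => //=; last exact: filterT.
  exact: nbhs_right_gt.
rewrite ler_pdivlMr//.
have [_] : 0 <= t + p.1 * u /\ Phi t x + z.1 * (t + p.1 * u - t) + dotp z.2 (x + p.1 *: p.2 - x)
   - s * ((t + p.1 * u - t) ^+ 2 + dotp (x + p.1 *: p.2 - x) (x + p.1 *: p.2 - x))
   <= Phi (t + p.1 * u) (x + p.1 *: p.2).
  by near: p; exact: (pF _ sP).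
have qe : u * z.1 + dotp v z.2 - e < u * z.1 + dotp p.2 z.2 - s * p.1 * (u ^+ 2 + dotp p.2 p.2).
  by near: p; apply: cvgr_gt qF _ _; rewrite ltrBlDr ltrDl.
have := ler_wpM2r (ltW p0) (ltW qe).
rewrite !(addrC t) !(addrC x) !addrK !dotpZl !dotpZr (dotpC z.2) => h1 h2.
nra.
Unshelve. all: by end_near. Qed.

Lemma dini_supergradientN Phi t x z : dini_supergradient Phi t x z <->
  dini_subgradient (fun s y => - Phi s y) t x (- z).
Proof.
suff lowerN a v : lower_dini (fun s y => - Phi s y) t x a v = (- upper_dini Phi t x a v)%E.
  by split=> H u v; have := H u v; rewrite lowerN /= mulrN dotpNr -opprD EFinN leeN2.
rewrite /lower_dini /upper_dini -limf_einfN; congr limf_einf.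
apply/funext => p; rewrite /dini_quotient /=.
by rewrite -mulNr opprB opprK addrC.
Qed.

End gradients.

(** * Proximal approximation of Dini subgradients *)

Section penalty.
Context {R : realType} {n : nat}.
Implicit Types (rho : R) (q : R * 'rV[R]_n) (v : 'rV[R]_n).

(** The square of the positive part has a Lipschitz derivative, so it lies below
its tangent parabolas.  This is what makes it usable in proximal test functions. *)
Lemma sqr_pospart_le (a b : R) : Num.max 0 b ^+ 2 <=
  Num.max 0 a ^+ 2 + 2 * Num.max 0 a * (b - a) + (b - a) ^+ 2.
Proof.
rewrite (_ : _ + _ + _ = (Num.max 0 a + (b - a)) ^+ 2); last by ring.
have [b0|b0] := leP b 0; first by rewrite expr0n/= sqr_ge0.
have ab : a <= Num.max 0 a by rewrite le_max lexx orbT.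
by rewrite lerXn2r ?nnegrE; lra.
Qed.

(** A C^1 penalty that vanishes exactly on the cone [|y_i| <= rho * t].  Each term
is a function of an affine form that is nonincreasing along every velocity
[(1, v)] with [|v| <= rho]. *)
Definition cone_penalty rho q : R :=
  \sum_(i < n) (Num.max 0 (q.2 0 i - rho * q.1) ^+ 2 +
                Num.max 0 (- q.2 0 i - rho * q.1) ^+ 2).

Lemma cone_penalty_ge0 rho q : 0 <= cone_penalty rho q.
Proof. by apply: sumr_ge0 => i _; rewrite addr_ge0// sqr_ge0. Qed.

Lemma cone_penalty_axis rho (t : R) : 0 <= rho * t -> cone_penalty rho (t, 0) = 0.
Proof.
move=> rt; apply: big1 => i _; rewrite /= mxE oppr0 add0r max_l ?oppr_le0//.
by rewrite expr0n addr0.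
Qed.

Lemma cone_penalty_outside rho q (a : R) : 0 < a -> 0 <= rho * q.1 ->
  a + rho * q.1 <= `|q.2| -> a ^+ 2 <= cone_penalty rho q.
Proof.
move=> a0 rq aq.
have q0 : mx_norm q.2 != 0 by rewrite gt_eqF// (lt_le_trans _ aq)// ltr_wpDr.
have [[k i] /= yi] := mx_norm_neq0 q0.
have {}aq : a + rho * q.1 <= `|q.2 0 i| by rewrite -(ord1 k) -yi.
rewrite /cone_penalty (bigD1 i)//= -[leLHS]addr0 lerD//; last first.
  by apply: sumr_ge0 => j _; rewrite addr_ge0// sqr_ge0.
have [y0|y0] := lerP 0 (q.2 0 i).
  rewrite ger0_norm// in aq; rewrite -[leLHS]addr0 lerD ?sqr_ge0//.
  by rewrite max_r ?lerXn2r ?nnegrE; lra.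
rewrite ltr0_norm// in aq; rewrite -[leLHS]add0r lerD ?sqr_ge0//.
by rewrite max_r ?lerXn2r ?nnegrE; lra.
Qed.

Lemma continuous_pospart2 (f : R * 'rV[R]_n -> R) : continuous f ->
  continuous (fun q => Num.max 0 (f q) ^+ 2).
Proof.
move=> cf q; apply: (@continuous_comp _ _ _ f (fun a : R => Num.max 0 a ^+ 2)); first exact: cf.
apply: (@continuous_comp _ _ _ (fun a : R => Num.max 0 a) (fun a => a ^+ 2)).
  by apply: continuous_max; [exact: cvg_cst|exact: cvg_id].
exact: exprn_continuous.
Qed.

Lemma continuous_cone_penalty rho : continuous (cone_penalty rho).
Proof.
have cy i : continuous (fun q : R * 'rV[R]_n => q.2 0 i).
  move=> q; apply: (@continuous_comp _ _ _ snd (fun y : 'rV[R]_n => y 0 i)).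
    exact: cvg_snd.
  exact: coord_continuous.
have ct : continuous (fun q : R * 'rV[R]_n => rho * q.1).
  by move=> q; apply: cvgM; [exact: cvg_cst|exact: cvg_fst].
apply: continuous_big => [|i _]; first exact: add_continuous.
move=> q; apply: cvgD; apply: continuous_pospart2 => {}q; apply: cvgB; try exact: ct.
  exact: cy.
by apply: cvgN; exact: cy.
Qed.

(** The gradient of the penalty at [q] is [2 * (- rho * S, c)].  The bound on
[dotp v c] says that the penalty does not increase along [(1, v)]. *)
Lemma cone_penalty_le rho q : 0 <= rho -> exists (c : 'rV[R]_n) (S : R),
  (forall v, `|v| <= rho -> dotp v c <= rho * S) /\
  forall q', cone_penalty rho q' <= cone_penalty rho q +
    2 * (dotp (q'.2 - q.2) c - rho * (q'.1 - q.1) * S) +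
    2 * (dotp (q'.2 - q.2) (q'.2 - q.2) + n%:R * (rho * (q'.1 - q.1)) ^+ 2).
Proof.
move=> rho0.
pose A i := Num.max 0 (q.2 0 i - rho * q.1).
pose B i := Num.max 0 (- q.2 0 i - rho * q.1).
have A0 i : 0 <= A i by rewrite le_max lexx.
have B0 i : 0 <= B i by rewrite le_max lexx.
exists (\row_i (A i - B i)), (\sum_i (A i + B i)); split => [v vr|q'].
  rewrite mulr_sumr; apply: ler_sum => i _; rewrite mxE.
  have := le_trans (coord_le_norm v i) vr; rewrite ler_norml => /andP[v1 v2].
  have := A0 i; have := B0 i; nra.
rewrite /cone_penalty /dotp mulr_sumr -sumrB.
have nE k : n%:R * k = \sum_(i < n) k :> R by rewrite sumr_const card_ord mulr_natl.
rewrite nE -[in 2 * (_ + _)]big_split/= !mulr_sumr -!big_split/=; apply: ler_sum => i _; rewrite !mxE.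
have := sqr_pospart_le (q.2 0 i - rho * q.1) (q'.2 0 i - rho * q'.1).
have := sqr_pospart_le (- q.2 0 i - rho * q.1) (- q'.2 0 i - rho * q'.1).
rewrite -/(A i) -/(B i); lra.
Qed.

End penalty.

Section dini_to_proximal.
Context {R : realType} {n : nat}.
Implicit Types (Phi : R -> 'rV[R]_n -> R).

(** Only the directions [(1, w)] are used.  For them the neighborhoods of [w] in
the definition of the lower derivative cover the ball of radius [rho], and
compactness makes the bound on the time step uniform. *)
Lemma dini_subgradient_cone Phi (s : R) x z (rho e : R) :
  0 <= s -> dini_subgradient Phi s x z -> 0 < e ->
  \forall r \near 0^'+, forall w, `|w| <= rho ->
    r * (z.1 + dotp w z.2 - e) <= Phi (s + r) (x + r *: w) - Phi s x.
Proof.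
move=> s0 zD e0.
have cz (v : 'rV[R]_n) : dotp w z.2 @[w --> v] --> dotp v z.2.
  by apply: (@cvg_dotp _ _ _ (nbhs v)); [exact: cvg_id|exact: cvg_cst].
have /compact_near_coveringP cK := @compact_closed_ball_rV R n 0 rho.
suff H : \forall r \near 0^'+, [set w : 'rV[R]_n | `|w - 0| <= rho] `<=`
    (fun w => r * (z.1 + dotp w z.2 - e) <= Phi (s + r) (x + r *: w) - Phi s x).
  by apply: filterS H => r Hr w wr; apply: Hr; rewrite /= subr0.
apply: (cK R (0^'+) (fun r w =>
  r * (z.1 + dotp w z.2 - e) <= Phi (s + r) (x + r *: w) - Phi s x)) => v _.
have e20 : 0 < e / 2 by rewrite divr_gt0.
have /lower_dini_geP/(_ _ e20) [[A B] /= [A0 Bv] AB] := zD 1 v.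
have vz : \forall w \near v, dotp w z.2 < dotp v z.2 + e / 2.
  by apply: cvgr_lt (cz v) _ _; rewrite ltrDl.
exists (B `&` [set w | dotp w z.2 < dotp v z.2 + e / 2], A `&` [set r | 0 < r]) => /=.
  by split; apply: filterI => //; exact: nbhs_right_gt.
move=> [w r] [/= [Bw wv] [Ar r0]].
have := AB (r, w) (conj Ar Bw); rewrite /= mulr1 mul1r => /(_ (addr_ge0 s0 (ltW r0))).
rewrite ler_pdivlMr// => Q; rewrite (le_trans _ Q)// mulrC ler_pM2r//; lra.
Qed.

(** On a small box [0 <= t <= h], [|y| <= 2 * rho * h] around the point, minimize
[Phi] minus the linear form, plus [e * t] to gain on the top face, plus the cone
penalty to gain on the lateral faces, plus a penalty [M * (tau - t)^+ ^+ 2] to gain on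
the face [t = 0].  The minimum is then interior, and the gradient there of the
test function is the proximal subgradient.  The last two penalties do not increase
along the velocities [(1, v)], so they can only help in the pairing. *)
Lemma dini_subgradient_approx Phi (s : R) x z (rho e : R) U :
  continuous (fun p => Phi p.1 p.2) -> 0 <= s -> dini_subgradient Phi s x z ->
  0 < rho -> 0 < e -> nbhs (s, x) U ->
  exists t y z', [/\ 0 < t, U (t, y), proximal_subgradient Phi t y z' &
    forall v, `|v| <= rho -> z.1 + dotp v z.2 - e <= z'.1 + dotp v z'.2].
Proof.
move=> cPhi s0 zD rho0 e0 Usx.
have e20 : 0 < e / 2 by rewrite divr_gt0.
pose Q0 (q : R * 'rV[R]_n) :=
  Phi (s + q.1) (x + q.2) - Phi s x - z.1 * q.1 - dotp q.2 z.2 + e * q.1.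
have cQ0 : continuous Q0.
  move=> q; rewrite /Q0; apply: cvgD; last first.
    by apply: cvgM; [exact: cvg_cst|exact: cvg_fst].
  apply: cvgB; last by apply: cvg_dotp; [exact: cvg_snd|exact: cvg_cst].
  apply: cvgB; last by apply: cvgM; [exact: cvg_cst|exact: cvg_fst].
  apply: cvgB; last exact: cvg_cst.
  apply: (@continuous_comp _ _ _ (fun q => (s + q.1, x + q.2)) (fun p => Phi p.1 p.2)).
    apply: (@cvg_pair _ _ _ _ (nbhs (s + q.1)) (nbhs (x + q.2))).
      by apply: cvgD; [exact: cvg_cst|exact: cvg_fst].
    by apply: cvgD; [exact: cvg_cst|exact: cvg_snd].
  exact: cPhi.
have [d d0 dU] : exists2 d, 0 < d & forall q, `|q| < d -> U (s + q.1, x + q.2).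
  have /nbhs_ballP[d /= d0 dU] := Usx; exists d => // q; rewrite prod_normE/= gt_max => /andP[q1 q2].
  by apply: dU; split; rewrite -ball_normE/= opprD addrA subrr sub0r normrN.
(* The cone bound is needed with aperture [2 * rho], so that it covers the whole top
   face of a box whose lateral faces are outside the cone of aperture [rho]. *)
have [h [h0 hd rhd cone]] : exists h : R, [/\ 0 < h, h < d, 2 * rho * h < d &
    forall r, 0 < r <= h -> forall w, `|w| <= 2 * rho ->
    r * (z.1 + dotp w z.2 - e / 2) <= Phi (s + r) (x + r *: w) - Phi s x].
  have /nbhs_ballP[k /= k0 kP] := dini_subgradient_cone (2 * rho) s0 zD e20.
  have dr0 : 0 < d / (2 * rho) by rewrite divr_gt0// mulr_gt0.
  exists (Num.min k (Num.min d (d / (2 * rho))) / 2).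
  have m0 : 0 < Num.min k (Num.min d (d / (2 * rho))) by rewrite !lt_min k0 d0 dr0.
  have m1 : Num.min k (Num.min d (d / (2 * rho))) <= k by rewrite ge_min lexx.
  have m2 : Num.min k (Num.min d (d / (2 * rho))) <= d by rewrite !ge_min lexx orbT.
  have m3 : Num.min k (Num.min d (d / (2 * rho))) <= d / (2 * rho).
    by rewrite !ge_min lexx !orbT.
  split; [by lra|by lra| |].
    by rewrite mulrC -ltr_pdivlMr ?mulr_gt0//; lra.
  move=> r /andP[r0 rh]; apply: kP => //; rewrite /ball/= sub0r normrN gtr0_norm//; lra.
have Q0_top y : `|y| <= 2 * rho * h -> e / 2 * h <= Q0 (h, y).
  move=> yh; have := cone h _ (h^-1 *: y); rewrite h0 lexx => /(_ isT).
  rewrite normrZ gtr0_norm ?invr_gt0// mulrC ler_pdivrMr// => /(_ yh).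
  rewrite scalerA divff ?gt_eqF// scale1r dotpZl.
  rewrite !mulrDr mulrA divff ?gt_eqF// mul1r /Q0 /=; lra.
pose K := `[0, h]%classic `*` [set y : 'rV[R]_n | `|y - 0| <= 2 * rho * h].
have K0 : K !=set0.
  exists (0, 0); split => /=; first by rewrite in_itv/= lexx ltW.
  by rewrite subr0 normr0 !mulr_ge0 ?ltW.
have cK : compact K by apply: compact_setX; [exact: segment_compact|exact: compact_closed_ball_rV].
have [B B0 BQ] : exists2 B, 0 < B & forall q, K q -> - B <= Q0 q.
  have [c _ cmin] := compact_EVT_min K0 cK (continuous_subspaceT cQ0).
  exists (`|Q0 c| + 1); first by rewrite ltr_wpDl.
  move=> q /mem_set /cmin; apply: le_trans; rewrite lerNl.
  by have := ler_norm (- Q0 c); rewrite normrN => /le_trans; apply; rewrite lerDl.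
have eh0 : 0 < e / 2 * h by rewrite mulr_gt0.
(* The point [(tau, 0)] lies in the cone and escapes the penalty near [t = 0]; it
   is the competitor that beats every face. *)
have [tau [tau0 tauh Q0tau]] : exists tau : R, [/\ 0 < tau, tau < h & Q0 (tau, 0) < e / 2 * h].
  have : \forall tau \near 0^'+, [/\ 0 < tau, tau < h & Q0 (tau, 0) < e / 2 * h].
    have : \forall tau \near (0 : R), Q0 (tau, 0) < e / 2 * h.
      have : Q0 (tau, 0) @[tau --> (0 : R)] --> Q0 (0, 0).
        have c0 : (tau, 0 : 'rV[R]_n) @[tau --> (0 : R)] --> (0 : R, 0 : 'rV[R]_n).
          apply: (@cvg_pair _ _ _ _ (nbhs (0 : R)) (nbhs (0 : 'rV[R]_n))).
            exact: cvg_id.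
          exact: cvg_cst.
        exact: (cvg_comp _ _ c0 (cQ0 _)).
      move/cvgr_lt; apply; rewrite /Q0/= !addr0 subrr !mulr0 dotpC dotp0r; lra.
    move=> Htau; near=> tau; split; near: tau; [exact: nbhs_right_gt|exact: nbhs_right_lt|].
    exact: cvg_within Htau.
  by move=> /filter_ex.
pose M := (B + e / 2 * h) / tau ^+ 2.
pose Q := (B + e / 2 * h) / (rho * h) ^+ 2.
have M0 : 0 < M by rewrite divr_gt0 ?exprn_gt0// addr_gt0.
have Qp0 : 0 < Q by rewrite divr_gt0 ?exprn_gt0 ?mulr_gt0// addr_gt0.
pose G q := Q0 q + Q * cone_penalty rho q + M * Num.max 0 (tau - q.1) ^+ 2.
have cG : continuous G.
  move=> q; apply: cvgD.
    apply: cvgD; first exact: cQ0.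
    by apply: cvgM; [exact: cvg_cst|exact: continuous_cone_penalty].
  apply: cvgM; first exact: cvg_cst.
  apply: (@continuous_pospart2 _ _ (fun q => tau - q.1)) => {}q.
  by apply: cvgB; [exact: cvg_cst|exact: cvg_fst].
have [q qK qmin] := compact_EVT_min K0 cK (continuous_subspaceT cG).
have Gq : G q < e / 2 * h.
  apply: (le_lt_trans (qmin (tau, 0) _)).
    apply/mem_set; split => /=; first by rewrite in_itv/= !ltW.
    by rewrite subr0 normr0 !mulr_ge0 ?ltW.
  rewrite /G cone_penalty_axis ?mulr_ge0 ?ltW//= subrr maxxx expr0n/=.
  by rewrite !mulr0 !addr0.
have [] := set_mem qK; rewrite /= in_itv/= subr0 => /andP[q10 q1h] q2h.
have P0 := cone_penalty_ge0 rho q.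
have T0 : 0 <= M * Num.max 0 (tau - q.1) ^+ 2 by rewrite mulr_ge0 ?sqr_ge0 ?ltW.
have QP0 : 0 <= Q * cone_penalty rho q by rewrite mulr_ge0 ?P0 ?(ltW Qp0).
have qB := BQ _ (set_mem qK).
have {}q10 : 0 < q.1.
  rewrite lt_neqAle q10 andbT; apply: contraTN Gq => /eqP q1.
  rewrite -leNgt /G -q1 subr0 max_r ?(ltW tau0)// /M divfK ?gt_eqF ?exprn_gt0//; lra.
have {}q1h : q.1 < h.
  rewrite lt_neqAle q1h andbT; apply: contraTN Gq => /eqP q1.
  rewrite -leNgt /G.
  have : e / 2 * h <= Q0 q by rewrite (surjective_pairing q) q1; exact: Q0_top.
  lra.
have {}q2h : `|q.2| < 2 * rho * h.
  rewrite lt_neqAle q2h andbT; apply: contraTN Gq => /eqP q2.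
  have /(ler_wpM2l (ltW Qp0)) : (rho * h) ^+ 2 <= cone_penalty rho q.
    apply: cone_penalty_outside; [exact: mulr_gt0|by rewrite mulr_ge0 ?ltW|].
    have := ler_wpM2l (ltW rho0) (ltW q1h); rewrite q2; lra.
  rewrite [leLHS]divfK ?gt_eqF ?exprn_gt0 ?mulr_gt0// -leNgt /G; lra.
have [c [S [cv cP]]] := cone_penalty_le q (ltW rho0).
have stq : 0 < s + q.1 by rewrite ltr_wpDl.
exists (s + q.1), (x + q.2).
exists (z.1 - e + 2 * Q * rho * S + 2 * M * Num.max 0 (tau - q.1), z.2 - (2 * Q) *: c).
split => //.
- by apply: dU; rewrite prod_normE gt_max/= gtr0_norm// (lt_trans q1h)// (lt_trans q2h).
- apply/proximal_subgradientP; exists (2 * Q * (1 + n%:R * rho ^+ 2) + M).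
    apply: addr_gt0 => //; apply: mulr_gt0; first by rewrite mulr_gt0.
    by have := mulr_ge0 (ler0n R n) (sqr_ge0 rho); lra.
  have near1 : \forall p \near (s + q.1, x + q.2), K (p.1 - s, p.2 - x) /\ 0 <= p.1.
    have c1 : p.1 @[p --> (s + q.1, x + q.2)] --> s + q.1 by exact: cvg_fst.
    have c2 : p.1 - s @[p --> (s + q.1, x + q.2)] --> q.1.
      rewrite [X in _ --> X](_ : q.1 = s + q.1 - s); last by ring.
      by apply: cvgB; [exact: c1|exact: cvg_cst].
    have c3 : `|p.2 - x| @[p --> (s + q.1, x + q.2)] --> `|q.2|.
      rewrite [X in _ --> X](_ : `|q.2| = `|x + q.2 - x|); last by rewrite addrAC subrr add0r.
      apply: cvg_norm.
      by apply: cvgB; [exact: cvg_snd|exact: cvg_cst].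
    near=> p; split; last by apply/ltW; near: p; exact: cvgr_gt c1 _ _.
    split => /=; last by rewrite subr0; apply/ltW; near: p; exact: cvgr_lt c3 _ _.
    rewrite in_itv/=; apply/andP; split; apply/ltW; near: p.
      exact: cvgr_gt c2 _ _.
    exact: cvgr_lt c2 _ _.
  apply: filterS near1 => p [pK p0]; split => //.
  have := qmin _ (mem_set pK); rewrite /G.
  have := ler_wpM2l (ltW Qp0) (cP (p.1 - s, p.2 - x)).
  have := ler_wpM2l (ltW M0) (sqr_pospart_le (tau - q.1) (tau - (p.1 - s))).
  rewrite /Q0 /= !(addrC s) !(addrC x) !subrK.
  have -> : p.2 - (q.2 + x) = p.2 - x - q.2 by rewrite opprD addrA addrAC.
  have -> : dotp (p.2 - x) z.2 = dotp q.2 z.2 + dotp (p.2 - x - q.2) z.2.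
    by rewrite -dotpDl addrCA subrr addr0.
  set dy := p.2 - x - q.2.
  have -> : dotp (z.2 - (2 * Q) *: c) dy = dotp dy z.2 - 2 * Q * dotp dy c.
    by rewrite dotpC dotpBr dotpZr.
  have r1 : 0 <= 2 * Q * (p.1 - (q.1 + s)) ^+ 2
    by apply: mulr_ge0; [lra|exact: sqr_ge0].
  have r2 : 0 <= (2 * Q * (n%:R * rho ^+ 2) + M) * dotp dy dy.
    apply: mulr_ge0; last exact: dotp_ge0.
    apply: addr_ge0; last exact: ltW.
    apply: mulr_ge0; first lra.
    by apply: mulr_ge0; [exact: ler0n|exact: sqr_ge0].
  move: r1 r2; lra.
- move=> v vr /=; rewrite dotpBr dotpZr.
  have := cv _ vr.
  have : 0 <= 2 * M * Num.max 0 (tau - q.1)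
    by apply: mulr_ge0; [lra|rewrite le_max lexx].
  move=> h1 /(ler_wpM2l (ltW Qp0)); lra.
Unshelve. all: by end_near.
Qed.

End dini_to_proximal.

(** * Duality of proximal sub- and supergradients along a vector field *)

Section proximal_duality.
Context {R : realType} {n : nat}.
Implicit Types (Phi : R -> 'rV[R]_n -> R) (d e p : R * 'rV[R]_n).

Definition weighted_sqr (Ct Cx : R) d : R := Ct * d.1 ^+ 2 + Cx * dotp d.2 d.2.

Lemma weighted_sqrD Ct Cx d e : weighted_sqr Ct Cx (d + e) = weighted_sqr Ct Cx d +
  2 * (Ct * (d.1 * e.1) + Cx * dotp d.2 e.2) + weighted_sqr Ct Cx e.
Proof.
rewrite /weighted_sqr /= !dotpDl !dotpDr (dotpC e.2 d.2); ring.
Qed.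

Lemma weighted_sqr_ge0 Ct Cx d : 0 <= Ct -> 0 <= Cx -> 0 <= weighted_sqr Ct Cx d.
Proof.
by move=> t0 x0; apply: addr_ge0; apply: mulr_ge0 => //; [exact: sqr_ge0|exact: dotp_ge0].
Qed.

Lemma weighted_sqr1_ge d : `|d| ^+ 2 <= weighted_sqr 1 1 d.
Proof.
rewrite /weighted_sqr !mul1r prod_normE /=.
have h1 := sqr_norm_le_dotp d.2; have h2 := dotp_ge0 d.2; have h3 := sqr_ge0 d.1.
case: (leP `|d.1| `|d.2|) => _; first lra.
by rewrite real_normK ?num_real//; lra.
Qed.

Lemma continuous_weighted_sqr Ct Cx : continuous (weighted_sqr Ct Cx).
Proof.
move=> d; apply: cvgD; apply: cvgM; try exact: cvg_cst.
  apply: (@continuous_comp _ _ _ fst (fun a : R => a ^+ 2)); first exact: cvg_fst.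
  exact: exprn_continuous.
by apply: (@cvg_dotp _ _ _ (nbhs d)); exact: cvg_snd.
Qed.

(** If [d] maximizes [Phi (p - d + d')] minus a quadratic form of [d'], then a
parabola touches [Phi] from above at [p], with slope the gradient of the form at
[d]. *)
Lemma quadratic_max_supergradient Phi p d (r Ct Cx : R) :
  0 <= Ct -> 0 <= Cx -> 0 < p.1 -> `|d| < r ->
  (forall d', `|d'| <= r ->
     Phi (p - d + d').1 (p - d + d').2 - weighted_sqr Ct Cx d' <=
     Phi p.1 p.2 - weighted_sqr Ct Cx d) ->
  proximal_subgradient (fun t x => - Phi t x) p.1 p.2 (- (2 * Ct * d.1, (2 * Cx) *: d.2)).
Proof.
move=> Ct0 Cx0 p0 dr dmax; apply/proximal_subgradientP; exists (Ct + Cx + 1).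
  by rewrite ltr_wpDl// addr_ge0.
rewrite -surjective_pairing.
have cp : `|d + (q - p)| @[q --> p] --> `|d|.
  rewrite [X in _ --> X](_ : `|d| = `|d + (p - p)|); last by rewrite subrr addr0.
  apply: cvg_norm; apply: cvgD; first exact: cvg_cst.
  by apply: cvgB; [exact: cvg_id|exact: cvg_cst].
near=> q; split.
  by apply/ltW; near: q; apply: (cvgr_gt p.1); [exact: cvg_fst|].
have /dmax : `|d + (q - p)| <= r by apply/ltW; near: q; exact: cvgr_lt cp _ _.
rewrite addrA subrK addrC subrK weighted_sqrD /weighted_sqr /= dotpNl dotpZl.
have := sqr_ge0 (q.1 - p.1); have := dotp_ge0 (q.2 - p.2).
nra.
Unshelve. all: by end_near. Qed.

End proximal_duality.

Section sup_convolution.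
Context {R : realType} {n : nat}.
Implicit Types (Phi : R -> 'rV[R]_n -> R).

Lemma nbhs_closed_ball {V : normedModType R} (p : V) (P : set V) : nbhs p P ->
  exists2 r, 0 < r & forall q, `|q - p| <= r -> P q.
Proof.
move=> /nbhs_ballP[r /= r0 rP]; exists (r / 2); first by rewrite divr_gt0.
move=> q qr; apply: rP; rewrite -ball_normE/= distrC; lra.
Qed.

(** The maximum of this over small [d] is the sup-convolution of [Phi] at [p]. *)
Definition penalized Phi (Ct Cx : R) (p d : R * 'rV[R]_n) : R :=
  Phi (p + d).1 (p + d).2 - weighted_sqr Ct Cx d.

Lemma penalized0 Phi Ct Cx p : penalized Phi Ct Cx p 0 = Phi p.1 p.2.
Proof. by rewrite /penalized /weighted_sqr /= dotp0r !addr0 expr0n/= !mulr0 addr0 subr0. Qed.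

(** Existence of the sup-convolution, with the two weights chosen at different
scales.  The weight [Cx] is fixed first, from the modulus of continuity [kappa] of
[Phi] at scale [r].  Slopes in space are then of size [Cx * r], and the weight [Ct]
is taken so large that maximizers move in time by less than [rt], where [rt] is so
small that the oscillation [omega] of [F] in time, times these slopes, is at most
[e].  This makes continuity of [F] in time sufficient. *)
Lemma sup_convolution Phi (F : R -> 'rV[R]_n -> 'rV[R]_n) (p0 : R * 'rV[R]_n)
    (rho kappa e : R) :
  continuous (fun p => Phi p.1 p.2) -> continuous (fun p => F p.1 p.2) ->
  0 < rho -> 0 < kappa -> 0 < e ->
  exists r rt Ct Cx omega (m : R * 'rV[R]_n -> R * 'rV[R]_n),
  [/\ [/\ 0 < rt, rt <= r, r <= rho, 0 < Ct & 0 < Cx],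
      forall p d, `|d| <= r -> penalized Phi Ct Cx p d <= penalized Phi Ct Cx p (m p),
      continuous (fun p => penalized Phi Ct Cx p (m p)),
      forall p, `|p - p0| <= rho ->
        [/\ penalized Phi Ct Cx p (m p) <= Phi p.1 p.2 + kappa, `|(m p).1| <= rt / 2,
            `|(m p).2| <= r / 2 & Cx * `|(m p).2| ^+ 2 <= kappa] &
      [/\ 0 <= omega, 2 * n%:R * Cx * r * omega <= e &
        forall tau p, `|p - p0| <= rho -> `|tau| <= rt ->
        `|F (p.1 + tau) p.2 - F p.1 p.2| <= omega]].
Proof.
move=> cPhi cF rho0 kappa0 e0.
pose K := [set p : R * 'rV[R]_n | `|p - p0| <= rho].
have cK : compact K by exact: compact_closed_ball_pair.
have [r [r0 rrho rP]] : exists r, [/\ 0 < r, r <= rho & forall d p, `|d| <= r -> K p ->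
    Phi (p + d).1 (p + d).2 - Phi p.1 p.2 < kappa].
  pose g (q : (R * 'rV[R]_n) * (R * 'rV[R]_n)) := Phi (q.2 + q.1).1 (q.2 + q.1).2.
  have cg : continuous g.
    move=> q; apply: (@cvg_comp _ _ _ (fun q => q.2 + q.1) (fun p => Phi p.1 p.2) _
        (nbhs (q.2 + q.1))).
      by apply: cvgD; [exact: cvg_snd|exact: cvg_fst].
    exact: cPhi.
  have /nbhs_closed_ball[r r0 rP] :=
    @compact_near_uniform _ _ _ R^o K g 0 kappa cK (fun x _ => cg (0, x)) kappa0.
  exists (Num.min r rho); split; first by rewrite lt_min r0.
    by rewrite ge_min lexx orbT.
  move=> d p dr Kp; have := rP d; rewrite subr0 => /(_ _ _ Kp).
  have drr : `|d| <= r by move: dr; rewrite le_min => /andP[].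
  by rewrite /g /= !addr0 => /(_ drr); rewrite ltr_norml => /andP[].
(* A maximizer pays at most [kappa]; the factor 4 keeps it at distance [r / 2]. *)
pose Cx := 4 * kappa / r ^+ 2.
have Cx0 : 0 < Cx by rewrite divr_gt0 ?exprn_gt0 ?mulr_gt0.
pose omega := e / (2 * n%:R * Cx * r + 1).
have den0 : 0 < 2 * n%:R * Cx * r + 1.
  have := mulr_ge0 (mulr_ge0 (ler0n R n) (ltW Cx0)) (ltW r0); clear; lra.
have omega0 : 0 < omega by rewrite divr_gt0.
have omegaP : 2 * n%:R * Cx * r * omega <= e.
  apply: (@le_trans _ _ ((2 * n%:R * Cx * r + 1) * omega)).
    by apply: ler_wpM2r; [exact: ltW|lra].
  by rewrite /omega mulrC divfK ?gt_eqF.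
have [rt [rt0 rtr rtP]] : exists rt, [/\ 0 < rt, rt <= r & forall tau p, `|tau| <= rt -> K p ->
    `|F (p.1 + tau) p.2 - F p.1 p.2| < omega].
  pose g (q : R * (R * 'rV[R]_n)) := F (q.2.1 + q.1) q.2.2.
  have cg : continuous g.
    move=> q; apply: (@continuous_comp _ _ _ (fun q => (q.2.1 + q.1, q.2.2)) (fun p => F p.1 p.2)).
      apply: (@cvg_pair _ _ _ _ (nbhs (q.2.1 + q.1)) (nbhs q.2.2)).
        apply: cvgD; last exact: cvg_fst.
        by apply: (@cvg_comp _ _ _ snd fst _ (nbhs q.2)); [exact: cvg_snd|exact: cvg_fst].
      by apply: (@cvg_comp _ _ _ snd snd _ (nbhs q.2)); [exact: cvg_snd|exact: cvg_snd].
    exact: cF.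
  have /nbhs_closed_ball[rt rt0 rtP] :=
    @compact_near_uniform _ _ _ _ K g 0 omega cK (fun x _ => cg (0, x)) omega0.
  exists (Num.min rt r); split; first by rewrite lt_min rt0.
    by rewrite ge_min lexx orbT.
  move=> d p dr Kp; have := rtP d; rewrite subr0 => /(_ _ _ Kp).
  rewrite /g /= !addr0; apply.
  by move: dr; rewrite le_min => /andP[].
pose Ct := 4 * kappa / rt ^+ 2.
have Ct0 : 0 < Ct by rewrite divr_gt0 ?exprn_gt0 ?mulr_gt0.
pose W := @weighted_sqr R n Ct Cx.
have cW : continuous W by exact: continuous_weighted_sqr.
pose Kd := [set d : R * 'rV[R]_n | `|d - 0| <= r].
have Kd0 : Kd 0 by rewrite /Kd /= subrr normr0 ltW.
have cKd : compact Kd by exact: compact_closed_ball_pair.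
pose g (q : (R * 'rV[R]_n) * (R * 'rV[R]_n)) := penalized Phi Ct Cx q.1 q.2.
have cg : continuous g.
  move=> q; apply: cvgB.
    apply: (@cvg_comp _ _ _ (fun q => q.1 + q.2) (fun p => Phi p.1 p.2) _
        (nbhs (q.1 + q.2))).
      by apply: cvgD; [exact: cvg_fst|exact: cvg_snd].
    exact: cPhi.
  by apply: (@cvg_comp _ _ _ snd W _ (nbhs q.2)); [exact: cvg_snd|exact: cW].
have [m [mK mmax cm]] := compact_marginal (ex_intro _ 0 Kd0) cKd cg.
have gain p : K p -> Phi (p + m p).1 (p + m p).2 < Phi p.1 p.2 + kappa.
  move=> Kp; have := rP (m p) p; have := mK p; rewrite /Kd /= subr0 => mr /(_ mr Kp).
  by rewrite ltrBlDl.
have mW p : K p -> W (m p) <= kappa.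
  move=> Kp; have := mmax p 0 Kd0; have := gain p Kp.
  rewrite /g penalized0 /penalized /W; clear; lra.
have mt p : K p -> `|(m p).1| <= rt / 2.
  move=> Kp; rewrite -(@ler_pXn2r _ 2) ?nnegrE ?divr_ge0 ?(ltW rt0)//.
  rewrite real_normK ?num_real// exprMn -(ler_pM2l Ct0).
  have -> : Ct * (rt ^+ 2 * 2^-1 ^+ 2) = kappa by rewrite /Ct; field; rewrite gt_eqF.
  have := mW _ Kp; have := dotp_ge0 (m p).2 => /(mulr_ge0 (ltW Cx0)).
  rewrite /W /weighted_sqr; clear; lra.
have mx p : K p -> Cx * `|(m p).2| ^+ 2 <= kappa.
  move=> Kp; have := mW _ Kp; have := sqr_ge0 (m p).1 => /(mulr_ge0 (ltW Ct0)).
  have := ler_wpM2l (ltW Cx0) (sqr_norm_le_dotp (m p).2).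
  rewrite /W /weighted_sqr; clear; lra.
have mx2 p : K p -> `|(m p).2| <= r / 2.
  move=> Kp; rewrite -(@ler_pXn2r _ 2) ?nnegrE ?divr_ge0 ?(ltW r0)//.
  rewrite exprMn -(ler_pM2l Cx0).
  have -> : Cx * (r ^+ 2 * 2^-1 ^+ 2) = kappa by rewrite /Cx; field; rewrite gt_eqF.
  exact: mx.
exists r, rt, Ct, Cx, omega, m; split => //.
- by move=> p d dr; apply: (mmax p d); rewrite /Kd /= subr0.
- move=> p Kp; split; [|exact: mt|exact: mx2|exact: mx].
  have := gain p Kp; have := weighted_sqr_ge0 (m p) (ltW Ct0) (ltW Cx0).
  rewrite /penalized; clear; lra.
- by split=> [||tau p Kp taur]; [exact: ltW| |exact/ltW/rtP].
Qed.

Lemma weighted_sqrBZ (Ct Cx h : R) (d e : R * 'rV[R]_n) :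
  weighted_sqr Ct Cx (d - h *: e) = weighted_sqr Ct Cx d -
    2 * h * (Ct * (d.1 * e.1) + Cx * dotp d.2 e.2) + h ^+ 2 * weighted_sqr Ct Cx e.
Proof.
rewrite weighted_sqrD /weighted_sqr /= !(dotpNr, dotpNl, dotpZr, dotpZl).
by rewrite -[h *: e.1]/(h * e.1); ring.
Qed.

(** With slope [2 * C * a], a displacement of size [|a| + h * b], a Lipschitz constant
[k] and a time oscillation [omega], the error made by freezing the field: the
dangerous term is [C * |a| ^+ 2], which the sup-convolution keeps small. *)
Lemma dotp_increment_le (G a : 'rV[R]_n) (C k omega r h b : R) :
  0 <= C -> 0 <= k -> 0 <= omega -> 0 <= h -> 0 <= b -> `|a| <= r ->
  `|G| <= k * (`|a| + h * b) + omega ->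
  2 * C * dotp G a <= 2 * (n%:R * k) * (C * `|a| ^+ 2) +
    h * (2 * n%:R * C * k * r * b) + 2 * n%:R * C * r * omega.
Proof.
move=> C0 k0 omega0 h0 b0 ar GP.
have nC0 := mulr_ge0 (ler0n R n) C0.
have := ler_wpM2l C0 (le_trans (ler_norm _) (norm_dotp_le G a)).
have := ler_wpM2l nC0 (ler_wpM2r (normr_ge0 a) GP).
have := ler_wpM2l (mulr_ge0 (mulr_ge0 (mulr_ge0 nC0 k0) h0) b0) ar.
have := ler_wpM2l (mulr_ge0 nC0 omega0) ar.
clear; lra.
Qed.

Lemma near_right_small (a b : R) : 0 < b -> \forall h \near 0^'+, h * a <= b.
Proof.
move=> b0.
have ha0 : h * a @[h --> (0 : R)] --> 0 * a by apply: cvgM; [exact: cvg_id|exact: cvg_cst].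
have hab : \forall h \near 0, h * a <= b by apply: cvgr_le ha0 _ _; rewrite mul0r.
exact: cvg_within hab.
Qed.

(** The test function [phi], with its contact made strict, touches [Phi] from below
at [p0].  The sup-convolution [M] of [Phi] is uniformly close to [Phi], so [M - phi]
has an interior minimum [ph] near [p0].  Let [d] be a maximizer in the definition
of [M] at [ph - h * V], where [V] is the field at [ph].  At [P = ph - h * V + d] there is
a proximal supergradient of [Phi], twice the weighted [d].  Using the same point
[P] as a competitor in [M ph] bounds [M (ph - h * V) - M ph] above, minimality bounds
it below by the increment of [phi]; dividing by [h] shows that the supergradient
pairs with [V] at most as the gradient of [phi] does.  The inequality assumed at
[P] is thus transferred to [p0], up to the error of replacing the field at [P] by
the field at [ph].  The component [v0] of the field is constant, so the large slope
in time causes no error; in space the error is of order [Cx * |d.2| ^+ 2], by the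
Lipschitz condition. *)
Lemma proximal_super_to_sub Phi (F : R -> 'rV[R]_n -> 'rV[R]_n)
    (L : R -> 'rV[R]_n -> R) (v0 k : R) :
  continuous (fun p => Phi p.1 p.2) -> continuous (fun p => F p.1 p.2) ->
  continuous (fun p => L p.1 p.2) -> 0 <= k ->
  (forall t x y, `|F t x - F t y| <= k * `|x - y|) ->
  (forall t x z, proximal_subgradient (fun t x => - Phi t x) t x (- z) ->
     0 <= v0 * z.1 + dotp (F t x) z.2 + L t x) ->
  forall t x z, proximal_subgradient Phi t x z ->
     0 <= v0 * z.1 + dotp (F t x) z.2 + L t x.
Proof.
move=> cPhi cF cL k0 Flip super t0 x0 z zP.
have t00 := proximal_subgradient_gt0 zP.
have /proximal_subgradientP[s s0 sP] := zP.
pose p0 : R * 'rV[R]_n := (t0, x0).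
pose phi (p : R * 'rV[R]_n) := Phi t0 x0 + z.1 * (p.1 - t0) + dotp z.2 (p.2 - x0)
   - (s + 1) * weighted_sqr 1 1 (p - p0).
(* The pairing of the field with the gradient of [phi]. *)
pose A (p : R * 'rV[R]_n) := v0 * (z.1 - 2 * (s + 1) * (p.1 - t0)) +
   dotp (F p.1 p.2) (z.2 - (2 * (s + 1)) *: (p.2 - x0)).
have cA : continuous A.
  move=> p; apply: cvgD.
    apply: cvgM; first exact: cvg_cst.
    apply: cvgB; first exact: cvg_cst.
    apply: cvgM; first exact: cvg_cst.
    by apply: cvgB; [exact: cvg_fst|exact: cvg_cst].
  apply: (@cvg_dotp _ _ _ (nbhs p)); first exact: cF.
  apply: cvgB; first exact: cvg_cst.
  apply: cvgZ; first exact: cvg_cst.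
  by apply: cvgB; [exact: cvg_snd|exact: cvg_cst].
have cphi : continuous phi.
  move=> p; apply: cvgB; last first.
    apply: cvgM; first exact: cvg_cst.
    apply: (@cvg_comp _ _ _ (fun p => p - p0) (weighted_sqr 1 1) _ (nbhs (p - p0))).
      by apply: cvgB; [exact: cvg_id|exact: cvg_cst].
    exact: continuous_weighted_sqr.
  apply: cvgD.
    apply: cvgD; first exact: cvg_cst.
    apply: cvgM; first exact: cvg_cst.
    by apply: cvgB; [exact: cvg_fst|exact: cvg_cst].
  apply: (@cvg_dotp _ _ _ (nbhs p)); first exact: cvg_cst.
  by apply: cvgB; [exact: cvg_snd|exact: cvg_cst].
(* One fifth for each of: the oscillations of [A] and [L], the Lipschitz error, the
   time oscillation of the field, and the terms of order [h]. *)
apply/ler_addgt0Pr => eps eps_gt0; pose e := eps / 5.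
have e0 : 0 < e by rewrite divr_gt0.
have [rho rho0 rhoP] : exists2 rho, 0 < rho & forall p, `|p - p0| <= 2 * rho ->
   [/\ 0 < p.1, A p < A p0 + e, L p.1 p.2 < L t0 x0 + e &
       phi p + weighted_sqr 1 1 (p - p0) <= Phi p.1 p.2].
  have : \forall p \near p0,
   [/\ 0 < p.1, A p < A p0 + e, L p.1 p.2 < L t0 x0 + e &
       phi p + weighted_sqr 1 1 (p - p0) <= Phi p.1 p.2].
    near=> p; split.
    - by near: p; apply: (cvgr_gt t0); [exact: cvg_fst|].
    - by near: p; apply: (cvgr_lt (A p0)); [exact: cA|rewrite ltrDl].
    - by near: p; apply: (cvgr_lt (L t0 x0)); [exact: (cL p0)|rewrite ltrDl].
    - near: p; apply: filterS sP => p [_]; rewrite /phi /weighted_sqr /=; lra.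
  move=> /nbhs_closed_ball[r r0 rP]; exists (r / 2); first by rewrite divr_gt0.
  by move=> p pr; apply: rP; move: pr; clear; lra.
have nk0 : 0 <= n%:R * k by rewrite mulr_ge0.
have [kappa [kappa0 kapparho kappae]] : exists kappa : R,
    [/\ 0 < kappa, kappa < rho ^+ 2 & 2 * (n%:R * k) * kappa <= e].
  have : \forall kappa \near (0 : R)^'+, [/\ 0 < kappa, kappa < rho ^+ 2 &
      2 * (n%:R * k) * kappa <= e].
    near=> kappa; split; near: kappa; first exact: nbhs_right_gt.
      by apply: nbhs_right_lt; rewrite exprn_gt0.
    by apply: filterS (near_right_small (2 * (n%:R * k)) e0) => c; rewrite mulrC.
  by move=> /filter_ex.
have [r [rt [Ct [Cx [omega [m [[rt0 rtr rrho Ct0 Cx0] mmax cm mP [omega0 omegaP FP]]]]]]]] :=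
  sup_convolution p0 cPhi cF rho0 kappa0 e0.
have r0 : 0 <= r by rewrite (le_trans _ rtr) ?ltW.
pose M p := penalized Phi Ct Cx p (m p).
have M_ge p : Phi p.1 p.2 <= M p by rewrite -(penalized0 Phi Ct Cx); apply: mmax; rewrite normr0.
have Kp0 : `|p0 - p0| <= rho by rewrite subrr normr0 ltW.
have [ph phK phmin] : exists2 p, `|p - p0| <= rho & forall q, `|q - p0| <= rho ->
    M p - phi p <= M q - phi q.
  have cK := @compact_closed_ball_pair R n p0 rho.
  have [|p pK pmin] := @compact_EVT_min _ _ (fun p => M p - phi p) _ (ex_intro _ p0 Kp0) cK.
    by apply: continuous_subspaceT => p; apply: cvgB; [exact: cm|exact: cphi].
  by exists p; [exact: (set_mem pK)|move=> q qK; apply: pmin; exact/mem_set].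
have Kin p : `|p - p0| <= rho -> `|p - p0| <= 2 * rho.
  by move=> /le_trans; apply; move: rho0; clear; lra.
have phrho : `|ph - p0| < rho.
  rewrite lt_neqAle [X in _ && X]phK andbT; apply: contraPneq kapparho => phrho.
  apply/negP; rewrite -leNgt -phrho (le_trans (weighted_sqr1_ge _))//.
  have [_ _ _] := rhoP ph (Kin _ phK).
  have := phmin _ Kp0; have := M_ge ph; have [+ _ _ _] := mP p0 Kp0.
  have -> : phi p0 = Phi t0 x0 by rewrite /phi /weighted_sqr /= !subrr !dotp0r; ring.
  rewrite -/(M p0); clear; lra.
pose Fh := F ph.1 ph.2.
pose V : R * 'rV[R]_n := (v0, Fh).
pose c1 := weighted_sqr Ct Cx V + (s + 1) * weighted_sqr 1 1 V +
  2 * n%:R * Cx * k * r * `|Fh|.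
have [h [h0 hrt hrho hc]] : exists h, [/\ 0 < h, h * `|V| <= rt / 2,
    h * `|V| <= rho - `|ph - p0| & h * c1 <= e].
  apply: (@filter_ex _ (0 : R)^'+).
  near=> h; split; near: h; first exact: nbhs_right_gt.
  - by apply: near_right_small; rewrite divr_gt0.
  - by apply: near_right_small; rewrite subr_gt0.
  - exact: near_right_small.
have normhV : `|h *: V| = h * `|V| by rewrite normrZ gtr0_norm.
pose d := m (ph - h *: V).
have Kh : `|ph - h *: V - p0| <= rho.
  rewrite addrAC (le_trans (ler_normB _ _))// normhV.
  by move: hrho; clear; lra.
have [_ dt dx Cxdx] := mP _ Kh; rewrite -/d in dt dx Cxdx.
have dr : `|d| <= r / 2.
  by rewrite prod_normE ge_max /= dx andbT (le_trans dt)// ler_pM2r.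
pose P := ph - h *: V + d.
have dP : P - d = ph - h *: V by rewrite /P addrK.
have P2rho : `|P - p0| <= 2 * rho.
  rewrite /P addrAC (le_trans (ler_normD _ _))//.
  by move: Kh dr rrho r0; clear; lra.
have [P0 _ LP _] := rhoP _ P2rho.
have superP : proximal_subgradient (fun t x => - Phi t x) P.1 P.2
    (- (2 * Ct * d.1, (2 * Cx) *: d.2)).
  apply: (@quadratic_max_supergradient _ _ _ _ _ r); [exact: ltW|exact: ltW|exact: P0| |].
    by apply: le_lt_trans dr _; move: rtr rt0; clear; lra.
  by move=> d' dr'; rewrite dP; exact: (mmax (ph - h *: V) d' dr').
have Psuper : 0 <= v0 * (2 * Ct * d.1) + 2 * Cx * dotp (F P.1 P.2) d.2 + L P.1 P.2.
  by rewrite -dotpZr; exact: super superP.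
have step : 2 * (Ct * (d.1 * v0) + Cx * dotp d.2 Fh) <=
    A ph + h * (weighted_sqr Ct Cx V + (s + 1) * weighted_sqr 1 1 V).
  have E1 : ph + (d - h *: V) = P by rewrite /P addrA addrAC.
  have I1 : Phi P.1 P.2 - weighted_sqr Ct Cx (d - h *: V) <= M ph.
    rewrite -E1; apply: (mmax ph (d - h *: V)).
    rewrite (le_trans (ler_normB _ _))// normhV.
    by move: hrt dr rtr; clear; lra.
  have I2 : M (ph - h *: V) = Phi P.1 P.2 - weighted_sqr Ct Cx d by [].
  have phiE : phi (ph - h *: V) = phi ph - h * A ph - h ^+ 2 * ((s + 1) * weighted_sqr 1 1 V).
    rewrite /phi (addrAC ph) weighted_sqrBZ /A /= -/Fh.
    rewrite -[h *: v0]/(h * v0) (addrAC ph.2) (dotpBr z.2 (ph.2 - x0)) dotpZr.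
    by rewrite (dotpBr Fh) dotpZr (dotpC Fh (ph.2 - x0)) (dotpC Fh z.2); ring.
  rewrite -(ler_pM2l h0); have := phmin _ Kh; move: I1.
  by rewrite I2 phiE weighted_sqrBZ -[V.1]/v0 -[V.2]/Fh; clear; lra.
have FPh : `|F P.1 P.2 - Fh| <= k * (`|d.2| + h * `|Fh|) + omega.
  rewrite -(subrK (F P.1 ph.2) (F P.1 P.2)) -addrA (le_trans (ler_normD _ _))// lerD//.
    have -> : P.2 = ph.2 + (d.2 - h *: Fh) by rewrite /P /= -addrA (addrC d.2).
    rewrite (le_trans (Flip _ _ _))// ler_wpM2l// addrAC subrr add0r.
    by rewrite (le_trans (ler_normB _ _))// normrZ gtr0_norm.
  have -> : P.1 = ph.1 + (d.1 - h * v0) by rewrite /P /= -[h *: v0]/(h * v0); ring.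
  apply: FP => //; rewrite (le_trans (ler_normB _ _))// normrM gtr0_norm//.
  have Vv0 : `|v0| <= `|V| by rewrite [leRHS]prod_normE le_max lexx.
  have := ler_wpM2l (ltW h0) Vv0; move: hrt dt; clear; lra.
have d2r : `|d.2| <= r by rewrite (le_trans dx)// ler_pdivrMr// ler_peMr// ler1n.
have := dotp_increment_le (ltW Cx0) k0 omega0 (ltW h0) (normr_ge0 Fh) d2r FPh.
have := ler_wpM2l (mulr_ge0 (ler0n R 2) nk0) Cxdx.
rewrite dotpBl (dotpC Fh).
have [_ + _ _] := rhoP ph (Kin _ phK).
have -> : A p0 = v0 * z.1 + dotp (F t0 x0) z.2.
  by rewrite /A /= !subrr mulr0 scaler0 !subr0.
have -> : eps = 5 * e by rewrite /e; field.
move: hc; rewrite /c1 mulrDr.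
move: Psuper step LP kappae omegaP; clear; lra.
Unshelve. all: by end_near. Qed.

End sup_convolution.

(** * Extension to negative times *)

Section time_extension.
Context {R : realType} {n : nat}.
Implicit Types (Phi Psi : R -> 'rV[R]_n -> R).

Lemma within_continuous_total {X Y Z : topologicalType} (A : set Y) (f : Y -> Z) (h : X -> Y) :
  {within A, continuous f} -> continuous h -> (forall x, A (h x)) ->
  continuous (fun x => f (h x)).
Proof.
move=> /subspace_continuousP cf ch Ah x.
apply: cvg_comp (cf _ (Ah x)) => P /= hP.
by apply: (@filterS _ (nbhs x) _ _ _ _ (ch x _ hP)) => y Py; exact: Py (Ah y).
Qed.

Lemma proximal_subgradient_congr Phi Psi t x :
  (forall s y, 0 <= s -> Phi s y = Psi s y) -> 0 <= t ->
  proximal_subgradient Phi t x `<=` proximal_subgradient Psi t x.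
Proof.
move=> PP t0 z /proximal_subgradientP[s s0 sP]; apply/proximal_subgradientP.
by exists s => //; apply: filterS sP => p [p0]; rewrite !PP.
Qed.

(** Only points at nonnegative times enter a Dini derivative. *)
Lemma dini_subgradient_congr Phi Psi t x :
  (forall s y, 0 <= s -> Phi s y = Psi s y) -> 0 <= t ->
  dini_subgradient Phi t x `<=` dini_subgradient Psi t x.
Proof.
move=> PP t0 z zD u v; apply/lower_dini_geP => e e0.
have /lower_dini_geP/(_ e e0) := zD u v.
apply: (@filterS _ (filter_prod (0 : R)^'+ (nbhs v))) => p Hp p0.
by rewrite -!PP //; exact: Hp.
Qed.

Lemma dini_supergradient_congr Phi Psi t x :
  (forall s y, 0 <= s -> Phi s y = Psi s y) -> 0 <= t ->
  dini_supergradient Phi t x `<=` dini_supergradient Psi t x.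
Proof.
move=> PP t0 z /dini_supergradientN zD; apply/dini_supergradientN.
by apply: dini_subgradient_congr zD => // s y s0; rewrite PP.
Qed.

(** Freezing a function at its initial value for negative times makes it continuous
on the whole line, and does not affect gradients at nonnegative times. *)
Definition const_past {T} (g : R -> T) (t : R) : T := g (Num.max 0 t).

Lemma const_pastE {T} (g : R -> T) t : 0 <= t -> const_past g t = g t.
Proof. by move=> t0; rewrite /const_past max_r. Qed.

Lemma continuous_const_past {Z : topologicalType} (g : R -> 'rV[R]_n -> Z) :
  {within [set p : R * 'rV[R]_n | 0 <= p.1], continuous (fun p => g p.1 p.2)} ->
  continuous (fun p : R * 'rV[R]_n => const_past g p.1 p.2).
Proof.
move=> cg; apply: (within_continuous_total
  (h := fun p : R * 'rV[R]_n => (Num.max 0 p.1, p.2)) cg) => [p|p] /=.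
  apply: (@cvg_pair _ _ _ _ (nbhs (Num.max 0 p.1)) (nbhs p.2)); last exact: cvg_snd.
  by apply: continuous_max; [exact: cvg_cst|exact: cvg_fst].
by rewrite le_max lexx.
Qed.

Lemma continuous_const_past_control {m : nat} {Z : topologicalType}
    (g : R -> 'rV[R]_n -> 'rV[R]_m -> Z) :
  {within [set p : R * 'rV[R]_n * 'rV[R]_m | 0 <= p.1.1],
    continuous (fun p => g p.1.1 p.1.2 p.2)} ->
  continuous (fun p : R * 'rV[R]_n * 'rV[R]_m => const_past g p.1.1 p.1.2 p.2).
Proof.
move=> cg; apply: (within_continuous_total
  (h := fun p : R * 'rV[R]_n * 'rV[R]_m => ((Num.max 0 p.1.1, p.1.2), p.2)) cg) => [p|p] /=.
  apply: (@cvg_pair _ _ _ _ (nbhs (Num.max 0 p.1.1, p.1.2)) (nbhs p.2)); last exact: cvg_snd.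
  apply: (@cvg_comp _ _ _ fst (fun q => (Num.max 0 q.1, q.2)) _ (nbhs p.1)).
    exact: cvg_fst.
  apply: (@cvg_pair _ _ _ _ (nbhs (Num.max 0 p.1.1)) (nbhs p.1.2)); last exact: cvg_snd.
  by apply: continuous_max; [exact: cvg_cst|exact: cvg_fst].
by rewrite le_max lexx.
Qed.

End time_extension.

(** * Sign conditions on the Hamiltonian *)

Section hamiltonian_sign.
Context {R : realType} {n m : nat} (delta : R) (Omega : set 'rV[R]_m)
  (l : R -> 'rV[R]_n -> 'rV[R]_m -> R)
  (f : R -> 'rV[R]_n -> 'rV[R]_m -> 'rV[R]_n).
Implicit Types (S : set (R * 'rV[R]_n)) (p : R * 'rV[R]_n).

Lemma sup_hamiltonian_le0P S t x :
  (ereal_sup [set p.1%:E + hamiltonian delta Omega l f t x p.2 | p in S] <= 0)%E <->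
  forall p, S p -> forall e, 0 < e -> exists2 u, Omega u &
    p.1 + dotp (f t x u) p.2 + expR (- delta * t) * l t x u < e.
Proof.
split=> [H p Sp e e0|H].
  have : (p.1%:E + hamiltonian delta Omega l f t x p.2 <= 0)%E.
    by apply: le_trans H; apply: ereal_sup_ubound; exists p.
  rewrite -leeBrDl// sub0e => Hp.
  have /ereal_inf_lt[_ [u Ou <-]] : (hamiltonian delta Omega l f t x p.2 < (- p.1 + e)%:E)%E.
    by apply: le_lt_trans Hp _; rewrite -EFinN lte_fin ltrDl.
  rewrite lte_fin dotpC => hu; exists u => //; move: hu; clear; lra.
apply: ge_ereal_sup => _ [p Sp <-].
rewrite -leeBrDl// sub0e; apply/lee_addgt0Pr => e e0.
have [u Ou hu] := H p Sp e e0.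
apply: (@le_trans _ _ (dotp p.2 (f t x u) + expR (- delta * t) * l t x u)%:E).
  by apply: ereal_inf_lbound; exists u.
rewrite -EFinN -EFinD lee_fin dotpC; move: hu; clear; lra.
Qed.

Lemma inf_hamiltonian_ge0P S t x :
  (0 <= ereal_inf [set p.1%:E + hamiltonian delta Omega l f t x p.2 | p in S])%E <->
  forall p, S p -> forall u, Omega u ->
    0 <= p.1 + dotp (f t x u) p.2 + expR (- delta * t) * l t x u.
Proof.
split=> [H p Sp u Ou|H].
  have : (0 <= p.1%:E + hamiltonian delta Omega l f t x p.2)%E.
    by apply: le_trans H _; apply: ereal_inf_lbound; exists p.
  rewrite -leeBlDl// sub0e => Hp.
  have := le_trans Hp (ereal_inf_lbound (imageP _ Ou)).
  rewrite -EFinN lee_fin (dotpC p.2); clear; lra.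
apply: le_ereal_inf_tmp => _ [p Sp <-].
rewrite -leeBlDl// sub0e; apply: le_ereal_inf_tmp => _ [u Ou <-].
rewrite -EFinN lee_fin (dotpC p.2); have := H p Sp u Ou; clear; lra.
Qed.

End hamiltonian_sign.

(** * Equivalence of the proximal and Dini conditions *)

Theorem proposition11 (R : realType) (n m : nat)
    (l : R -> 'rV[R]_n -> 'rV[R]_m -> R)
    (f : R -> 'rV[R]_n -> 'rV[R]_m -> 'rV[R]_n)
    (Omega : set 'rV[R]_m) (delta : R)
    (Omega_neq0 : Omega !=set0) (delta_gt0 : 0 < delta)
    (A1 : assumptionA1 Omega l f)
    (A2 : assumptionA2 Omega l f)
    (A3 : assumptionA3 l f)
    (A4 : assumptionA4 delta Omega l f)
    (A5 : assumptionA5 Omega)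
    (Phi : R -> 'rV[R]_n -> R)
    (Phi_cont : {within [set p : R * 'rV[R]_n | 0 <= p.1],
                   continuous (fun p => Phi p.1 p.2)}) :
  ((forall (s : R) (z : 'rV[R]_n), 0 <= s ->
      (ereal_sup [set p.1%:E + hamiltonian delta Omega l f s z p.2
                 | p in proximal_subgradient Phi s z] <= 0)%E)
   <->
   (forall (s : R) (z : 'rV[R]_n), 0 <= s ->
      (ereal_sup [set p.1%:E + hamiltonian delta Omega l f s z p.2
                 | p in dini_subgradient Phi s z] <= 0)%E))
  /\
  ((forall (s : R) (z : 'rV[R]_n), 0 <= s ->
      (0 <= ereal_inf [set p.1%:E + hamiltonian delta Omega l f s z p.2
                      | p in proximal_subgradient Phi s z])%E)
   <->
   (forall (s : R) (z : 'rV[R]_n), 0 <= s ->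
      (0 <= ereal_inf [set p.1%:E + hamiltonian delta Omega l f s z p.2
                      | p in dini_supergradient Phi s z])%E)).
Proof.
have [K1 [K10 A1K]] := A1; have [K2 [K20 A2K]] := A2; have [lc fc] := A3.
pose Psi := const_past Phi.
have cPsi : continuous (fun p => Psi p.1 p.2) by exact: continuous_const_past.
have PhiPsi s z : 0 <= s -> Phi s z = Psi s z by move=> s0; rewrite /Psi const_pastE.
have PsiPhi s z : 0 <= s -> Psi s z = Phi s z by move=> s0; rewrite PhiPsi.
have cNPsi : continuous (fun p => - Psi p.1 p.2) by move=> p; apply: cvgN; exact: cPsi.
pose F u t x := const_past f t x u.
pose L u t x := expR (- delta * t) * const_past l t x u.
have FE u t x : 0 <= t -> F u t x = f t x u by move=> t0; rewrite /F const_pastE.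
have LE u t x : 0 <= t -> L u t x = expR (- delta * t) * l t x u.
  by move=> t0; rewrite /L const_pastE.
have cF3 := continuous_const_past_control fc.
have cL3 : continuous (fun p : R * 'rV[R]_n * 'rV[R]_m => L p.2 p.1.1 p.1.2).
  move=> p; apply: cvgM; last exact: (continuous_const_past_control lc).
  apply: (@cvg_comp _ _ _ (fun p => - delta * p.1.1) (@expR R) _ (nbhs (- delta * p.1.1))).
    apply: cvgM; first exact: cvg_cst.
    by apply: (@cvg_comp _ _ _ fst fst _ (nbhs p.1)); exact: cvg_fst.
  exact: continuous_expR.
have fix_control (Z : topologicalType) (g : R * 'rV[R]_n * 'rV[R]_m -> Z) u :
    continuous g -> continuous (fun p => g (p, u)).
  move=> cg p; apply: (@cvg_comp _ _ _ (fun p => (p, u)) g _ (nbhs (p, u))); last exact: cg.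
  by apply: (@cvg_pair _ _ _ _ (nbhs p) (nbhs u)); [exact: cvg_id|exact: cvg_cst].
have cF u : continuous (fun p => F u p.1 p.2) := fix_control _ _ u cF3.
have cL u : continuous (fun p => L u p.1 p.2) := fix_control _ _ u cL3.
have Flip u : Omega u -> forall t x y, `|F u t x - F u t y| <= K1 * n%:R * `|x - y|.
  move=> Ou t x y; have t0 : 0 <= Num.max 0 t by rewrite le_max lexx.
  have := A1K _ _ t0 Ou x y; rewrite -mulrA.
  have := ler_wpM2l (ltW K10) (enorm_le_norm (x - y)).
  have := norm_le_enorm (F u t x - F u t y).
  have := normr_ge0 (l (Num.max 0 t) x u - l (Num.max 0 t) y u).
  rewrite /F /const_past; clear; lra.
have kn0 : 0 <= K1 * n%:R by rewrite mulr_ge0 ?(ltW K10).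
have slack (e : R) : 0 < e -> 0 < e / 2 by move=> e0; rewrite divr_gt0.
split; split=> H s z s0.
(* If no control works at [(s, z)] for [e], then by compactness of [Omega] none works
   for [e / 2] nearby, which contradicts the hypothesis at a nearby proximal
   subgradient. *)
- apply/sup_hamiltonian_le0P => p pD e e0; apply: contrapT => noctrl.
  have big u : Omega u -> e <= p.1 + dotp (f s z u) p.2 + expR (- delta * s) * l s z u.
    by move=> Ou; rewrite leNgt; apply/negP => lt; apply: noctrl; exists u.
  pose g (q : R * 'rV[R]_n * 'rV[R]_m) : R^o :=
    p.1 + dotp (F q.2 q.1.1 q.1.2) p.2 + L q.2 q.1.1 q.1.2.
  have cg : continuous g.
    move=> q; apply: cvgD; last exact: cL3.
    apply: cvgD; first exact: cvg_cst.
    by apply: (@cvg_dotp _ _ _ (nbhs q)); [exact: cF3|exact: cvg_cst].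
  have gnear := compact_near_uniform A5 (fun u _ => cg ((s, z), u)) (slack _ e0).
  have fnear := compact_near_uniform A5 (fun u _ => cF3 ((s, z), u)) (@ltr01 R).
  pose rho := K2 * (1 + enorm z) + 1.
  have rho0 : 0 < rho by rewrite ltr_wpDl// mulr_ge0 ?(ltW K20)// addr_ge0// sqrtr_ge0.
  have pDPsi := dini_subgradient_congr PhiPsi s0 pD.
  have [t [y [q [t0 [gty fty] qP qp]]]] := dini_subgradient_approx cPsi s0 pDPsi rho0
    (slack _ (slack _ e0)) (filterI gnear fnear).
  have := H t y (ltW t0) => /sup_hamiltonian_le0P.
  have qPhi := proximal_subgradient_congr PsiPhi (ltW t0) qP.
  move=> /(_ q qPhi _ (slack _ (slack _ e0)))[u Ou].
  rewrite -(FE u _ _ (ltW t0)) -(LE u _ _ (ltW t0)) => qu.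
  have vu : `|F u t y| <= rho.
    have := fty u Ou => /=; have := A2K s z u s0 Ou.
    have := norm_le_enorm (f s z u); have := normr_ge0 (l s z u).
    rewrite -/(F u t y) -/(F u s z) (FE u s z s0).
    have := ler_normD (F u t y - f s z u) (f s z u); rewrite subrK.
    rewrite /rho; clear; lra.
  have := qp _ vu; have := gty u Ou; rewrite ltr_norml => /andP[+ _].
  have := big u Ou; rewrite -(FE u _ _ s0) -(LE u _ _ s0) /g /=; move: qu; clear; lra.
- apply/sup_hamiltonian_le0P => p /proximal_sub_dini_subgradient pD.
  by have /sup_hamiltonian_le0P := H s z s0; apply.
- apply/inf_hamiltonian_ge0P => p /dini_supergradientN pD u Ou.
  (* The duality for [- Phi] and the reversed field [(- 1, - f)]. *)
  have reversed t y q : proximal_subgradient (fun t x => - Psi t x) t y q ->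
      0 <= -1 * q.1 + dotp (- F u t y) q.2 + L u t y.
    apply: (@proximal_super_to_sub _ _ _ (fun t x => - F u t x) (L u) (-1) (K1 * n%:R)) => //.
    + by move=> x; apply: cvgN; exact: cF.
    + by move=> t' x y'; rewrite -opprD normrN; exact: Flip.
    move=> t' x q' q'P; have t'0 := proximal_subgradient_gt0 q'P.
    have q'Phi : proximal_subgradient Phi t' x (- q').
      apply: proximal_subgradient_congr q'P; last exact: ltW.
      by move=> ? ? ?; rewrite opprK PsiPhi.
    have /inf_hamiltonian_ge0P := H t' x (ltW t'0).
    move=> /(_ _ q'Phi u Ou).
    by rewrite /= -(FE u _ _ (ltW t'0)) -(LE u _ _ (ltW t'0)) dotpNr dotpNl mulN1r.
  rewrite -(FE u _ _ s0) -(LE u _ _ s0).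
  apply/ler_addgt0Pr => e e0.
  pose val (q : R * 'rV[R]_n) := p.1 + dotp (F u q.1 q.2) p.2 + L u q.1 q.2.
  have cval : continuous val.
    move=> q; apply: cvgD; last exact: cL.
    apply: cvgD; first exact: cvg_cst.
    by apply: (@cvg_dotp _ _ _ (nbhs q)); [exact: cF|exact: cvg_cst].
  have valnear : \forall q \near (s, z), val q < val (s, z) + e / 2.
    by apply: cvgr_lt (cval (s, z)) _ _; rewrite ltrDl slack.
  have Fnear : \forall q \near (s, z), `|F u q.1 q.2| < `|F u s z| + 1.
    by apply: cvgr_lt (cvg_norm (cF u (s, z))) _ _; rewrite ltrDl.
  have rho0 : 0 < `|F u s z| + 1 by rewrite ltr_wpDl.
  have pDPsi : dini_subgradient (fun t x => - Psi t x) s z (- p).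
    by apply: dini_subgradient_congr pD => // t x t0; rewrite PhiPsi.
  have [t [y [q [t0 [valty Fty] qP qp]]]] := dini_subgradient_approx cNPsi s0 pDPsi rho0
    (slack _ e0) (filterI valnear Fnear).
  have := reversed _ _ _ qP; have := qp _ (ltW Fty); move: valty.
  rewrite /val /= dotpNr dotpNl; clear; lra.
- apply/inf_hamiltonian_ge0P => p pP u Ou.
  rewrite -(FE u _ _ s0) -(LE u _ _ s0) -[p.1]mul1r.
  apply: (@proximal_super_to_sub _ _ Psi (F u) (L u) 1 (K1 * n%:R)) => //.
  + exact: Flip.
  + move=> t x q /[dup] /proximal_subgradient_gt0 t0 /proximal_sub_dini_subgradient.
    move=> /dini_supergradientN qD.
    have /inf_hamiltonian_ge0P := H t x (ltW t0).
    rewrite mul1r (FE u _ _ (ltW t0)) (LE u _ _ (ltW t0)); apply => //.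
    exact: dini_supergradient_congr PsiPhi (ltW t0) _ qD.
  exact: proximal_subgradient_congr PhiPsi s0 _ pP.
Qed.
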